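(* For every positive integer $k$, every $k$-coloring of the edges of the complete graph $K_n$ contains a monochromatic circuit (and hence a monochromatic trail) of length at least $\frac{1}{k^2-k+\frac{5}{4}}\binom{n}{2}+O_k(n)$. That is, for every $k$ there is a constant $C_k$ such that for every $n\ge 1$, every $k$-coloring of the edges of $K_n$ contains a monochromatic circuit of length at least $\frac{1}{k^2-k+\frac{5}{4}}\binom{n}{2}-C_k n$.
   Context: A $k$-coloring of the edges of $K_n$ is an arbitrary map from $E(K_n)$ to a set of $k$ colors (it need not be proper). A trail is a walk without repeated edges (vertices may repeat), and a circuit is a trail whose first and last vertices coincide (the trivial one-vertex circuit of length $0$ is allowed). The length of a trail or circuit is its number of edges. It is monochromatic if all of its edges have the same color. *)

(* Defs.v *)
From HB Require Import structures.
From mathcomp Require Import all_boot all_order all_algebra.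

Set Implicit Arguments.
Unset Strict Implicit.
Unset Printing Implicit Defensive.

(* Edges of the complete graph K_n on the vertex set 'I_n. *)
Definition edge (n : nat) : Type := {e : {set 'I_n} | #|e| == 2}.

(* A walk is given as in path.v: by its first vertex x and the sequence p of the
   vertices that follow, so that its length is size p. *)
Definition walk_edges (n : nat) (x : 'I_n) (p : seq 'I_n) : seq {set 'I_n} :=
  [seq [set u.1; u.2] | u <- zip (x :: p) p].

Definition is_walk (n : nat) (x : 'I_n) (p : seq 'I_n) : bool :=
  path (fun u v => u != v) x p.

Definition is_trail (n : nat) (x : 'I_n) (p : seq 'I_n) : bool :=
  is_walk x p && uniq (walk_edges x p).

Definition is_circuit (n : nat) (x : 'I_n) (p : seq 'I_n) : bool :=
  is_trail x p && (last x p == x).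

Definition monochromatic (n k : nat) (c : edge n -> 'I_k)
    (x : 'I_n) (p : seq 'I_n) : Prop :=
  forall e f : edge n,
    val e \in walk_edges x p -> val f \in walk_edges x p -> c e = c f.

(* Main.v *)
Require Import Defs.
From HB Require Import structures.
From mathcomp Require Import all_boot all_order all_algebra.
From mathcomp Require Import ring lra.
Set Implicit Arguments.
Unset Strict Implicit.
Unset Printing Implicit Defensive.
Import Order.TTheory GRing.Theory Num.Theory.
Local Open Scope ring_scope.

(* From each colour class delete at most n edges so that all degrees become
   even; then every monochromatic component carries an Eulerian circuit, and it
   suffices to find a component with many edges when O(n) edges are uncoloured.

   Count ordered pairs and suppose that every component contains at most s^2 of
   them. Let v_i be the component sizes of the largest colour, and w = sum v_i^2.
   - Component i has at most min(s^2, v_i^2) pairs; since this colour has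
     about n^2/k pairs, w cannot be much larger than s n.
   - The remaining n^2 - w pairs form a complete multipartite graph G, shared by
     the other k - 1 colours. The number of pairs of G within a set with part
     sizes u is q(u) = (sum u_j)^2 - sum u_j^2, a Lorentzian form, so the reverse
     Cauchy-Schwarz inequality makes sqrt q superadditive, and a subgraph of G
     with components of at most s^2 pairs has at most s sqrt(n^2 - w) pairs.
     Hence n^2 - w <= (k - 1)^2 s^2, up to O(n).
   Both bounds together force n^2 <= (k^2 - k + 5/4) s^2, up to O(n). *)

(** * A reverse Cauchy-Schwarz inequality and its sum over components *)

(** With q(u) = (sum u_j)^2 - sum u_j^2, the hypotheses give e^2 <= x q(u) and f^2 <= x q(v). The
    last factor is the polar form of q at u and v, which by reverse Cauchy-Schwarz is at least
    sqrt(q(u) q(v)). *)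
Lemma sum_cross_ge (R : realFieldType) (J : finType) (u v : J -> R) (x e f : R) :
    (forall j, 0 <= u j) -> (forall j, 0 <= v j) -> 0 <= e -> 0 <= f ->
    e <= x -> f <= x ->
    e <= (\sum_j u j) ^+ 2 - \sum_j u j ^+ 2 ->
    f <= (\sum_j v j) ^+ 2 - \sum_j v j ^+ 2 ->
  e * f <= x * ((\sum_j u j) * (\sum_j v j) - \sum_j u j * v j).
Proof.
move=> u0 v0 e0 f0 ex fx eq fq.
set a := \sum_j u j in eq *; set b := \sum_j v j in fq *.
set p := \sum_j u j ^+ 2 in eq; set q := \sum_j v j ^+ 2 in fq.
set c := \sum_j u j * v j.
have a0 : 0 <= a by apply: sumr_ge0.
have b0 : 0 <= b by apply: sumr_ge0.
have p0 : 0 <= p by apply: sumr_ge0 => j _; apply: sqr_ge0.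
have q0 : 0 <= q by apply: sumr_ge0 => j _; apply: sqr_ge0.
have x0 : 0 <= x by apply: le_trans ex.
have c_le : c <= a * b.
  rewrite /c /a mulr_suml; apply: ler_sum => j _; apply: ler_wpM2l => //.
  by rewrite /b (bigD1 j) //= lerDl sumr_ge0.
clearbody a b.
have B0 : 0 <= x * (a * b - c) by apply: mulr_ge0; rewrite // subr_ge0.
have [a00|a_neq0] := eqVneq a 0.
  have e_le0 : e <= 0.
    by apply: le_trans eq _; rewrite a00 expr0n /= sub0r oppr_le0.
  have -> : e = 0 by apply: le_anti; rewrite e_le0 e0.
  by rewrite mul0r.
have [b00|b_neq0] := eqVneq b 0.
  have f_le0 : f <= 0.
    by apply: le_trans fq _; rewrite b00 expr0n /= sub0r oppr_le0.
  have -> : f = 0 by apply: le_anti; rewrite f_le0 f0.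
  by rewrite mulr0.
have a_gt0 : 0 < a by rewrite lt_def a_neq0.
have b_gt0 : 0 < b by rewrite lt_def b_neq0.
(* Adding the bounds on [e ^+ 2] and [f ^+ 2] with weights [b ^+ 2] and [a ^+ 2], then using [h3] on
   the left and [key] on the right, yields the goal multiplied by [2%:R * (a * b)]. No square roots
   are taken. *)
have key : 0 <= b ^+ 2 * p + a ^+ 2 * q - 2%:R * (a * b) * c.
  have -> : b ^+ 2 * p + a ^+ 2 * q - 2%:R * (a * b) * c
      = \sum_j (b * u j - a * v j) ^+ 2.
    rewrite /p /q /c !mulr_sumr -big_split -sumrB; apply: eq_bigr => j _ /=.
    by ring.
  by apply: sumr_ge0 => j _; apply: sqr_ge0.
have he : e ^+ 2 <= x * (a ^+ 2 - p) by rewrite expr2; apply: ler_pM.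
have hf : f ^+ 2 <= x * (b ^+ 2 - q) by rewrite expr2; apply: ler_pM.
have h1 : b ^+ 2 * e ^+ 2 <= b ^+ 2 * (x * (a ^+ 2 - p)).
  by rewrite ler_wpM2l ?sqr_ge0.
have h2 : a ^+ 2 * f ^+ 2 <= a ^+ 2 * (x * (b ^+ 2 - q)).
  by rewrite ler_wpM2l ?sqr_ge0.
have h3 : 0 <= (b * e - a * f) ^+ 2 by apply: sqr_ge0.
have h4 := mulr_ge0 x0 key.
have ab_gt0 : 0 < 2%:R * (a * b) by rewrite !mulr_gt0.
rewrite -(ler_pM2l ab_gt0); lra.
Qed.

Lemma sqr_sum (R : comNzRingType) (I : finType) (f : I -> R) :
  (\sum_i f i) ^+ 2 = \sum_i \sum_j f i * f j.
Proof. by rewrite expr2 mulr_suml; under eq_bigr do rewrite mulr_sumr. Qed.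

(** Both sides expand into sums over ordered pairs (i, i'), diagonal included, and [sum_cross_ge]
    compares them term by term. *)
Lemma sum_components_le (R : realFieldType) (I J : finType)
    (u : I -> J -> R) (e : I -> R) (x : R) :
    (forall i j, 0 <= u i j) -> (forall i, 0 <= e i) -> (forall i, e i <= x) ->
    (forall i, e i <= (\sum_j u i j) ^+ 2 - \sum_j u i j ^+ 2) ->
  (\sum_i e i) ^+ 2
    <= x * ((\sum_i \sum_j u i j) ^+ 2 - \sum_j (\sum_i u i j) ^+ 2).
Proof.
move=> u0 e0 ex eq.
have -> : \sum_j (\sum_i u i j) ^+ 2 = \sum_i \sum_i' \sum_j u i j * u i' j.
  under eq_bigr do rewrite sqr_sum.
  by rewrite exchange_big /=; under eq_bigr do rewrite exchange_big /=.
rewrite !sqr_sum -sumrB mulr_sumr; apply: ler_sum => i _.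
rewrite -sumrB mulr_sumr; apply: ler_sum => i' _.
exact: sum_cross_ge.
Qed.

(** * Component sizes of the largest colour and the numerical estimate *)

(** [q] is the sum of the deficits d_i = s v_i - e_i, which are nonnegative because e_i <= min(s^2,
    v_i^2). A term with v_i < s is at most 0 on the left; otherwise s v_i = e_i + d_i <= s^2 + q and
    s (v_i - s) <= d_i. *)
Lemma sum_sqr_sizes_le (R : realFieldType) (I : finType) (v e : I -> R) (s : R) :
    0 <= s -> (forall i, 0 <= v i) ->
    (forall i, e i <= s ^+ 2) -> (forall i, e i <= v i ^+ 2) ->
    let q := s * \sum_i v i - \sum_i e i in
  0 <= q /\ s ^+ 2 * (\sum_i v i ^+ 2 - s * \sum_i v i) <= (s ^+ 2 + q) * q.
Proof.
move=> s0 v0 es ev q.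
have qE : q = \sum_i (s * v i - e i) by rewrite /q mulr_sumr sumrB.
clearbody q.
have d0 i : 0 <= s * v i - e i.
  rewrite subr_ge0; have [sv|vs] := leP s (v i).
    by apply: le_trans (es i) _; rewrite expr2 ler_wpM2l.
  by apply: le_trans (ev i) _; rewrite expr2 ler_wpM2r // ltW.
have q0 : 0 <= q by rewrite qE sumr_ge0.
have dq i : s * v i - e i <= q by rewrite qE (bigD1 i) //= lerDl sumr_ge0.
split=> //; rewrite [s * _]mulr_sumr -sumrB {2}qE !mulr_sumr. apply: ler_sum => i _.
have [sv|vs] := leP s (v i).
  have -> : s ^+ 2 * (v i ^+ 2 - s * v i) = (s * v i) * (s * (v i - s)) by ring.
  have := es i; have := dq i => h1 h2.
  by apply: ler_pM; rewrite ?mulr_ge0 ?subr_ge0 //; lra.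
apply: (@le_trans _ _ 0); last by rewrite mulr_ge0 // addr_ge0 ?sqr_ge0.
by rewrite mulr_ge0_le0 ?sqr_ge0 // subr_le0 expr2 ler_wpM2r // ltW.
Qed.

(** This is the scaled contradiction in [final_estimate], with t = n / z. For r = k - t the
    hypotheses give r < 1/2 and 2kr < k - 5/4 + r^2 <= k - 1, while the two sides differ by at most
    1 - k + 2kr. Thus 5/4 is 1 plus the bound 1/4 on r^2. *)
Lemma quartic_lt0 (R : realFieldType) (k t : R) :
    1 <= k -> 0 < t -> t <= k -> k ^+ 2 - k + 5%:R / 4%:R < t ^+ 2 ->
  (k - 1) ^+ 2 + t + (1 + (t - t ^+ 2 / k)) * (t - t ^+ 2 / k) < t ^+ 2.
Proof.
move=> k1 t0 tk hT; set a := t - t ^+ 2 / k; set r := k - t.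
have kn0 : k != 0 by rewrite lt0r_neq0 // (lt_le_trans ltr01).
have r0 : 0 <= r by rewrite subr_ge0.
have r_lt : r < 1 / 2%:R.
  rewrite ltNge; apply/negP => rge.
  have h : t ^+ 2 <= (k - 1 / 2%:R) ^+ 2.
    by rewrite lerXn2r // ?nnegrE; rewrite /r in rge; lra.
  have : (k - 1 / 2%:R) ^+ 2 = k ^+ 2 - k + 1 / 4%:R by field.
  lra.
have r2 : r ^+ 2 <= 1 / 4%:R.
  have : r * r <= (1/2%:R) * (1/2%:R) by apply: ler_pM => //; lra.
  by rewrite expr2; lra.
have h2 : 2%:R * k * r < k - 5%:R / 4%:R + r ^+ 2.
  have : t ^+ 2 = k ^+ 2 - 2%:R * k * r + r ^+ 2 by rewrite /r; ring.
  lra.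
have E : (k - 1) ^+ 2 + t + (1 + a) * a - t ^+ 2
  = 1 - k + 2%:R * k * r - r ^+ 2 / k * (1 + 2%:R * r - r ^+ 2 / k).
  by rewrite /a /r; field.
have h3 : 0 <= r ^+ 2 / k by rewrite divr_ge0 ?sqr_ge0 //; lra.
have h4 : r ^+ 2 / k <= 1.
  by rewrite ler_pdivrMr; lra.
have h5 : 0 <= r ^+ 2 / k * (1 + 2%:R * r - r ^+ 2 / k).
  by rewrite mulr_ge0 //; lra.
lra.
Qed.

Lemma final_estimate (R : realFieldType) (k n s D A w : R) :
    1 <= k -> 0 <= n -> 0 <= s -> 0 <= D ->
    n ^+ 2 <= k * A + D * n ->
    A <= s * n ->
    s ^+ 2 * (w - s * n) <= (s ^+ 2 + (s * n - A)) * (s * n - A) ->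
    n ^+ 2 <= w + (k - 1) ^+ 2 * s ^+ 2 + 2%:R * D * n ->
  n ^+ 2 <= (k ^+ 2 - k + 5%:R / 4%:R) * (s + 2%:R * D) ^+ 2.
Proof.
move=> k1 n0 s0 D0 hA hs hw hn; rewrite leNgt; apply/negP => hlt.
(* The shift by [2%:R * D] absorbs both errors: [z * n] includes the term [2%:R * D * n], and in
   [dd'] the factor [z] makes up for the loss of [D * n] in [hA]. *)
set z := s + 2%:R * D in hlt.
have z0 : 0 <= z by rewrite /z; lra.
have T1 : 1 <= k ^+ 2 - k + 5%:R / 4%:R.
  have : 0 <= k * (k - 1) by rewrite mulr_ge0 //; lra.
  have -> : k * (k - 1) = k ^+ 2 - k by ring.
  lra.
have zn : z < n.
  rewrite ltNge; apply/negP => nz.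
  have h1 : n ^+ 2 <= z ^+ 2 by rewrite lerXn2r // ?nnegrE.
  have : 1 * z ^+ 2 <= (k ^+ 2 - k + 5%:R / 4%:R) * z ^+ 2.
    by rewrite ler_wpM2r ?sqr_ge0.
  by lra.
have n_gt0 : 0 < n by lra.
have nD : 0 < n * (n - D) by apply: mulr_gt0 => //; rewrite /z in zn; lra.
have kA : 0 < k * A.
  have : n * (n - D) = n ^+ 2 - D * n by ring.
  lra.
have A_gt0 : 0 < A by move: kA; rewrite pmulr_rgt0 //; lra.
have s_gt0 : 0 < s.
  rewrite lt_def s0 andbT; apply/eqP => s00; rewrite s00 mul0r in hs; lra.
have z_gt0 : 0 < z by rewrite /z; lra.
have [sn0 zn0 kn0] : [/\ s != 0, z != 0 & k != 0].
  by split; apply: lt0r_neq0 => //; lra.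
(* [d] is the total deficit divided by [s]; [d'] is its error-free counterpart, with [n ^+ 2 / k]
   for [A] and [z] for [s]. *)
set d := n - A / s; set d' := n - n ^+ 2 / (k * z).
have d0 : 0 <= d by rewrite subr_ge0 ler_pdivrMr // mulrC.
have dd' : d <= d'.
  rewrite lerD2l lerN2 ler_pdivlMr // mulrAC ler_pdivrMr ?mulr_gt0 //; last lra.
  have h1 : (n ^+ 2 - D * n) * z <= k * A * z by rewrite ler_wpM2r //; lra.
  have h2 : 0 <= D * n * (2%:R * n - z) by rewrite !mulr_ge0 //; lra.
  have -> : A * (k * z) = k * A * z by ring.
  apply: le_trans h1; move: h2; rewrite /z => h2.
  have E : (n ^+ 2 - D * n) * (s + 2%:R * D)
    = n ^+ 2 * s + D * n * (2%:R * n - (s + 2%:R * D)) by ring.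
  by rewrite E; lra.
have hw' : w <= s * n + (s + d) * d.
  rewrite -subr_ge0 -(@pmulr_rge0 _ (s ^+ 2)) ?exprn_gt0 //.
  have E : s ^+ 2 * (s * n + (s + d) * d - w)
    = (s ^+ 2 + (s * n - A)) * (s * n - A) - s ^+ 2 * (w - s * n).
    by rewrite /d; field.
  by rewrite E subr_ge0.
have sz : s <= z by rewrite /z; lra.
have h1 : (s + d) * d <= (z + d') * d' by apply: ler_pM; lra.
have h2 : (k - 1) ^+ 2 * s ^+ 2 <= (k - 1) ^+ 2 * z ^+ 2.
  by rewrite ler_wpM2l ?sqr_ge0 // lerXn2r // ?nnegrE.
have h3 : n ^+ 2 <= (k - 1) ^+ 2 * z ^+ 2 + z * n + (z + d') * d'.
  have -> : z * n = s * n + 2%:R * D * n by rewrite /z; ring.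
  lra.
have tk : n / z <= k.
  have : 0 <= d' * (k * z) by rewrite mulr_ge0 ?mulr_ge0 //; lra.
  have -> : d' * (k * z) = n * (k * z - n) by rewrite /d'; field; rewrite zn0.
  by rewrite pmulr_rge0 // ler_pdivrMr //; lra.
have hT : k ^+ 2 - k + 5%:R / 4%:R < (n / z) ^+ 2.
  by rewrite expr_div_n ltr_pdivlMr ?exprn_gt0.
have := @quartic_lt0 R k (n / z) k1 (divr_gt0 n_gt0 z_gt0) tk hT.
rewrite /= -(ltr_pM2r (exprn_gt0 2 z_gt0)) ltNge => /negP; apply.
have -> : (n / z) ^+ 2 * z ^+ 2 = n ^+ 2 by field.
apply: le_trans h3 _; rewrite le_eqVlt; apply/orP; left; apply/eqP.
by rewrite /d'; field; rewrite kn0 zn0.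
Qed.

(** * Ordered pairs, parities of degrees and even subgraphs *)

(** A member of [L] arises from exactly two ordered pairs of distinct vertices if it has two
    elements, and from none otherwise. *)
Lemma card_pairs_in_edges (T : finType) (L : {set {set T}}) :
  (\sum_u \sum_v ((u != v) && ([set u; v] \in L) : nat) <= 2 * #|L|)%N.
Proof.
rewrite pair_bigA /= (eq_bigr (fun p : T * T => \sum_(e in L)
  ((p.1 != p.2) && ([set p.1; p.2] == e) : nat))%N); last first.
  move=> [u v] _ /=; case: (u != v) => /=; last by rewrite big1.
  have [L_uv|nL_uv] := boolP ([set u; v] \in L).
    rewrite (bigD1 [set u; v]) //= eqxx big1 // => e /andP[_].
    by rewrite eq_sym => /negPf->.
  by rewrite big1 // => e eL; case: eqP => // E; rewrite E eL in nL_uv.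
rewrite exchange_big /= mulnC -sum_nat_const; apply: leq_sum => e _.
rewrite -big_mkcond /= sum1_card.
have [[a b]|] := pickP [pred p : T * T | (p.1 != p.2) && ([set p.1; p.2] == e)];
  last by move/eq_card0 => ->.
case/andP=> /= ab /eqP abe.
suff sub : {subset [pred p : T * T | (p.1 != p.2) && ([set p.1; p.2] == e)]
              <= [:: (a, b); (b, a)]}.
  by apply: leq_trans (card_size [:: (a, b); (b, a)]); apply/subset_leq_card/subsetP.
move=> [u v] /andP[/= uv /eqP]; rewrite -abe => E.
have := in_set2 u a b; rewrite -E set21 => /esym.
have := in_set2 v a b; rewrite -E set22 => /esym.
by do 2![case/orP=> /eqP ?; subst]; rewrite ?eqxx in uv *; rewrite // !inE !eqxx ?orbT.
Qed.

Definition degree (T : finType) (F : {set {set T}}) (v : T) : nat :=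
  #|[set e in F | v \in e]|.

Definition even_graph (T : finType) (F : {set {set T}}) : Prop :=
  forall v, ~~ odd (degree F v).

Lemma degree_setU (T : finType) (F G : {set {set T}}) v :
  [disjoint F & G] -> degree (F :|: G) v = (degree F v + degree G v)%N.
Proof.
move=> dFG; rewrite /degree setIdE setIUl cardsU.
suff -> : F :&: [set e : {set T} | v \in e]
    :&: (G :&: [set e : {set T} | v \in e]) = set0.
  by rewrite cards0 subn0 !setIdE.
by rewrite setIACA (disjoint_setI0 dFG) set0I.
Qed.

Lemma odd_degree_symdiff (T : finType) (F G : {set {set T}}) v :
  odd (degree ((F :\: G) :|: (G :\: F)) v) = odd (degree F v) (+) odd (degree G v).
Proof.
have dis (A B : {set {set T}}) : [disjoint A :&: B & A :\: B].
  rewrite -setI_eq0; apply/eqP/setP=> e; rewrite !inE.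
  by case: (e \in B); rewrite ?andbF.
rewrite degree_setU; last first.
  rewrite -setI_eq0; apply/eqP/setP=> e; rewrite !inE.
  by case: (e \in F); rewrite /= ?andbF.
have degE (A B : {set {set T}}) :
    degree A v = (degree (A :&: B) v + degree (A :\: B) v)%N.
  by rewrite -degree_setU // setID.
rewrite (degE F G) (degE G F) (setIC G F) !oddD.
by do 3!case: (odd _).
Qed.

(* Pigeonhole: there are more edge sets than parity vectors, so two edge sets
   have the same parities, and their symmetric difference is even. *)
Lemma even_subgraph_neq0 (T : finType) (F : {set {set T}}) :
    (#|T| < #|F|)%N ->
  exists D : {set {set T}}, [/\ D \subset F, D != set0 & even_graph D].
Proof.
move=> TF; pose par (D : {set {set T}}) := [set v | odd (degree D v)].
have /dinjectivePn[D1 DF1 [D2 /andP[/= D12 DF2] E]] : ~~ dinjectiveb par (powerset F).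
  apply/negP=> /dinjectiveP inj.
  have := max_card (mem (par @: powerset F)).
  by rewrite card_in_imset // card_powerset -cardsT
    -powersetT card_powerset cardsT leqNgt ltn_exp2l ?TF.
rewrite !powersetE in DF1 DF2.
exists ((D1 :\: D2) :|: (D2 :\: D1)); split.
- by rewrite subUset !subDset !subsetU ?DF1 ?DF2 ?orbT.
- apply: contraNneq D12 => /eqP; rewrite setU_eq0 !setD_eq0 -eqEsubset eq_sym.
  by [].
- move=> v; rewrite odd_degree_symdiff.
  by have := congr1 (fun A : {set T} => v \in A) E; rewrite !inE => ->; rewrite addbb.
Qed.

(** Take [D] even of maximum size. If more than [#|T|] edges were left, they would contain a
    nonempty even set, and its disjoint union with [D] would be even and larger. *)
Lemma even_subgraph_large (T : finType) (F : {set {set T}}) :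
  exists D : {set {set T}},
    [/\ D \subset F, even_graph D & (#|F :\: D| <= #|T|)%N].
Proof.
pose P (D : {set {set T}}) := (D \subset F) && [forall v, ~~ odd (degree D v)].
have P0 : P set0.
  rewrite /P sub0set; apply/forallP=> v.
  rewrite /degree [X in #|pred_of_set X|](_ : _ = set0) ?cards0 //.
  by apply/setP=> e; rewrite !inE.
case: (arg_maxnP (fun D : {set {set T}} => #|D|) P0) => D /andP[DF /forallP evD] maxD.
exists D; split=> //; rewrite leqNgt; apply/negP.
case/even_subgraph_neq0=> E [EF E0 evE].
have dDE : [disjoint D & E].
  rewrite disjoint_sym; apply: disjointWl EF _.
  by rewrite disjoints_subset setDE subsetIr.
have /maxD /= : P (D :|: E).
  rewrite /P subUset DF (subset_trans EF (subsetDl _ _)); apply/forallP=> v.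
  by rewrite degree_setU // oddD (negPf (evD v)) (negPf (evE v)).
rewrite cardsU (disjoint_setI0 dDE) cards0 subn0 -[leqRHS]addn0 leq_add2l.
by rewrite leqn0 cards_eq0 (negPf E0).
Qed.

(** * Trails and Eulerian circuits *)

Lemma incidence_cons (n : nat) (x y : 'I_n) p v : x != y ->
  count (fun e : {set 'I_n} => v \in e) (walk_edges x (y :: p))
    = ((v == x) + (v == y) + count (fun e : {set 'I_n} => v \in e) (walk_edges y p))%N.
Proof.
move=> xy; rewrite /= in_set2; congr (_ + _)%N.
by have [->|] := eqVneq v x; rewrite // (negPf xy).
Qed.

(** Each edge counts once at both of its ends, so modulo 2 the inner vertices of the walk cancel. *)
Lemma odd_incidence (n : nat) (x : 'I_n) p v : is_walk x p ->
  odd (count (fun e : {set 'I_n} => v \in e) (walk_edges x p))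
    = (v == x) (+) (v == last x p).
Proof.
elim: p x => [|y p IHp] x; first by rewrite addbb.
case/andP=> xy yp; rewrite incidence_cons // !oddD IHp // !oddb.
by rewrite -addbA addKb.
Qed.

Lemma walk_edges_cat (n : nat) (x : 'I_n) p q :
  walk_edges x (p ++ q) = walk_edges x p ++ walk_edges (last x p) q.
Proof.
by elim: p x => //= y p IHp x; rewrite {1}/walk_edges /= -/(walk_edges _ _) IHp.
Qed.

Lemma is_walk_cat (n : nat) (x : 'I_n) p q :
  is_walk x (p ++ q) = is_walk x p && is_walk (last x p) q.
Proof. exact: cat_path. Qed.


Lemma degree_enum (T : finType) (F : {set {set T}}) v :
  degree F v = count (fun e : {set T} => v \in e) (enum F).
Proof.
rewrite /degree cardE -size_filter; congr size.
by rewrite /enum_mem -filter_predI; apply: eq_filter => e; rewrite !inE andbC.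
Qed.

(* An open trail uses an odd number of edges at its last vertex, hence leaves
   one of the evenly many edges of F there unused. *)
Lemma open_trail_unused_edge (n : nat) (F : {set {set 'I_n}}) (x : 'I_n) p :
    (forall e : {set 'I_n}, e \in F -> #|e| = 2%N) -> even_graph F ->
    is_trail x p -> {subset walk_edges x p <= F} -> last x p != x ->
  exists2 e, e \in F & (last x p \in e) && (e \notin walk_edges x p).
Proof.
move=> F2 evF /andP[wp up] pF lastx.
apply/exists_inP; apply: contraT => no_edge.
have all_used e : e \in F -> last x p \in e -> e \in walk_edges x p.
  move=> eF le; apply/negPn/negP=> ne; case/exists_inP: no_edge.
  by exists e; rewrite // le.
have odd_p := odd_incidence (last x p) wp.
rewrite eqxx (negPf lastx) /= in odd_p.
have := evF (last x p); rewrite degree_enum.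
suff -> : count (fun e : {set 'I_n} => last x p \in e) (enum F)
        = count (fun e : {set 'I_n} => last x p \in e) (walk_edges x p).
  by rewrite odd_p.
rewrite -!size_filter.
apply/perm_size/uniq_perm; [exact/filter_uniq/enum_uniq | exact: filter_uniq |].
move=> e.
rewrite [LHS]mem_filter [RHS]mem_filter mem_enum.
case: (boolP (last x p \in e)) => //= le.
by apply/idP/idP=> [/all_used|/pF]; first apply.
Qed.

Lemma trail_rcons (n : nat) (F : {set {set 'I_n}}) (x : 'I_n) p e :
    is_trail x p -> {subset walk_edges x p <= F} ->
    e \in F -> #|e| = 2%N -> last x p \in e -> e \notin walk_edges x p ->
  exists2 y, is_trail x (rcons p y) & {subset walk_edges x (rcons p y) <= F}.
Proof.
move=> /andP[wp up] pF eF /eqP/cards2P[a [b [ab eE]]] le ep.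
have [y yl Ey] : exists2 y, last x p != y & e = [set last x p; y].
  move: le; rewrite eE in_set2 => /orP[] /eqP->; first by exists b.
  by exists a; rewrite 1?eq_sym // setUC.
have We : walk_edges x (rcons p y) = rcons (walk_edges x p) e.
  by rewrite -cats1 walk_edges_cat -cats1 Ey.
exists y; rewrite ?/is_trail We.
  by rewrite -cats1 is_walk_cat wp /= yl rcons_uniq ep up.
by move=> f; rewrite mem_rcons inE => /orP[/eqP->|/pF].
Qed.

(** Cut at [y] and exchange the two halves; they fit together because the walk is closed. *)
Lemma circuit_rot (n : nat) (x : 'I_n) p y :
    is_circuit x p -> y \in x :: p ->
  exists q, [/\ is_circuit y q, perm_eq (walk_edges x p) (walk_edges y q)
    & size q = size p].
Proof.
case/andP=> /andP[wp up] /eqP lp yp; case/splitPl: yp wp up lp => p1 p2 Ey wp up lp.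
rewrite last_cat Ey in lp.
exists (p2 ++ p1).
have perm : perm_eq (walk_edges x (p1 ++ p2)) (walk_edges y (p2 ++ p1)).
  by rewrite !walk_edges_cat Ey lp perm_catC.
split=> //; last by rewrite !size_cat addnC.
rewrite /is_circuit /is_trail -(perm_uniq perm) up is_walk_cat last_cat lp Ey eqxx.
by move: wp; rewrite is_walk_cat Ey => /andP[-> ->].
Qed.

Lemma walk_edges_vertex (n : nat) (x : 'I_n) p e v :
  e \in walk_edges x p -> v \in e -> v \in x :: p.
Proof.
elim: p x => //= y p IHp x; rewrite inE => /orP[/eqP->|ep ve].
  by rewrite in_set2 !inE => /orP[]->; rewrite ?orbT.
by rewrite inE IHp ?orbT.
Qed.

Lemma size_walk_edges (n : nat) (x : 'I_n) p : size (walk_edges x p) = size p.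
Proof. by rewrite size_map size_zip /= minnC; apply/minn_idPl. Qed.

(* A longest trail in an even graph is closed, and after rotation it could be
   extended by any unused edge meeting it; so it exhausts its component. *)
Lemma euler_circuit (n : nat) (F : {set {set 'I_n}}) (x : 'I_n) :
    (forall e : {set 'I_n}, e \in F -> #|e| = 2%N) -> even_graph F ->
  exists y p, [/\ is_circuit y p, {subset walk_edges y p <= F}
    & forall u v, connect (fun a b => [set a; b] \in F) x u ->
        [set u; v] \in F -> [set u; v] \in walk_edges y p].
Proof.
move=> F2 evF; pose r := [rel a b : 'I_n | [set a; b] \in F].
(* [P m] says that some trail of length [m] in [F] starts in the component of [x]. The bound by
   [#|F|] provides a longest one. *)
pose P m := [exists t : m.-tuple 'I_n, [exists y, [&& connect r x y,
   is_trail y t & all (mem F) (walk_edges y t)]]].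
have P0 : exists m, P m.
  exists 0%N; apply/existsP; exists [tuple]; apply/existsP; exists x.
  by rewrite connect0.
have bnd m : P m -> (m <= #|F|)%N.
  case/existsP=> t /existsP[y /and3P[_ /andP[_ ut] /allP tF]].
  rewrite -(size_tuple t) -(size_walk_edges y t) cardE uniq_leq_size // => e /tF.
  by rewrite mem_enum.
have [m /existsP[t /existsP[y /and3P[xy tt /allP tF]]] maxm] := ex_maxnP P0 bnd.
have maxP z q : connect r x z -> is_trail z q ->
    {subset walk_edges z q <= F} -> (size q <= m)%N.
  move=> xz tq qF; apply: maxm; apply/existsP; exists (in_tuple q).
  by apply/existsP; exists z; rewrite xz tq; apply/allP.
have stuck z q e : connect r x z -> is_trail z q -> {subset walk_edges z q <= F} ->
    size q = m -> e \in F -> last z q \in e -> e \in walk_edges z q.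
  move=> xz tq qF sq eF le; apply/negPn/negP=> ne.
  have [w tw wF] := trail_rcons tq qF eF (F2 e eF) le ne.
  by have := maxP _ _ xz tw wF; rewrite size_rcons sq ltnn.
have cyc : is_circuit y t.
  rewrite /is_circuit tt; apply/negPn/negP=> lt.
  have [e eF /andP[le]] := open_trail_unused_edge F2 evF tt tF lt.
  by rewrite (stuck y t e) // size_tuple.
have rsym : connect_sym r by apply: sym_connect_sym => a b; rewrite /= setUC.
have reach : {in y :: t, forall z, connect r x z}.
  have reach_path q y' : connect r x y' -> {subset walk_edges y' q <= F} ->
      {in y' :: q, forall z, connect r x z}; last exact: reach_path xy tF.
  elim: q y' => [|w q IHq] y' xy' qF z; first by rewrite inE => /eqP->.
  rewrite inE => /orP[/eqP-> //|]; apply: IHq; last first.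
    by move=> e eq; apply: qF; rewrite inE eq orbT.
  by apply: connect_trans xy' (connect1 _); apply: qF; rewrite inE eqxx.
have full u e : u \in y :: t -> e \in F -> u \in e -> e \in walk_edges y t.
  move=> ut eF ue; have [q [/andP[tq /eqP lq] pq sq]] := circuit_rot cyc ut.
  rewrite (perm_mem pq); apply: (stuck u) => //; rewrite ?reach ?lq ?sq ?size_tuple //.
  by move=> f; rewrite -(perm_mem pq) => /tF.
(* Induction along a path from [y]: an edge leaving a vertex of the circuit is used by it, so its
   other end lies on the circuit too. *)
have closed_t u : connect r y u -> u \in y :: t.
  case/connectP=> q; elim/last_ind: q u => [|q w IHq] u.
    by move=> _ ->; rewrite mem_head.
  rewrite rcons_path last_rcons => /andP[yq lw] ->.
  have := full _ _ (IHq _ yq erefl) lw (set21 _ _).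
  by move/walk_edges_vertex; apply; rewrite set22.
exists y, t; split=> // u v xu uvF; apply: (full u) => //; last by rewrite set21.
by apply: closed_t; apply: connect_trans xu; rewrite rsym.
Qed.

(** * Counting ordered pairs over all colours *)

(** Both sides count the ordered pairs from [P] that lie in a common fibre of [f]. *)
Lemma sum_sqr_fibers (R : realFieldType) (T : finType) (f : T -> T) (P : pred T) :
  \sum_z (\sum_(a | P a && (f a == z)) 1) ^+ 2
    = \sum_(a | P a) \sum_(b | P b) (f a == f b)%:R :> R.
Proof.
rewrite [RHS](partition_big f predT) //=; apply: eq_bigr => z _.
rewrite expr2 mulr_suml; apply: eq_bigr => a /andP[_ /eqP fa].
rewrite mul1r big_mkcondr; apply: eq_bigr => b _.
by rewrite fa eq_sym; case: eqP.
Qed.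

Lemma sum_disjoint_le1 (R : realFieldType) (I : finType) (P : pred I) :
  (forall i j, P i -> P j -> i = j) -> \sum_i (P i)%:R <= 1 :> R.
Proof.
move=> uniqP; case: (pickP P) => [i Pi|P0]; last by rewrite big1 // => i _; rewrite P0.
rewrite (bigD1 i) //= Pi big1 ?addr0 // => j ji.
by case: (boolP (P j)) => // Pj; rewrite (uniqP _ _ Pj Pi) eqxx in ji.
Qed.

Lemma sum_component_le_sqr (R : realFieldType) (T : finType) (r : rel T)
    (f : T -> T) (z : T) :
    (forall u v, r u v -> f u = f v) ->
  \sum_(u | f u == z) \sum_v (r u v)%:R <= (\sum_(u | f u == z) 1) ^+ 2 :> R.
Proof.
move=> rf; rewrite expr2 mulr_suml; apply: ler_sum => u /eqP fu.
rewrite mul1r [leRHS]big_mkcond; apply: ler_sum => v _.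
by case: (boolP (r u v)) => [/rf<-|_]; rewrite ?fu ?eqxx //; case: ifP.
Qed.

(* The relation f u = f v plays the role of the components of the colour r, and
   the fibres of g are the parts of the complete multipartite graph G. *)
Lemma sum_crossing_le (R : realFieldType) (T : finType) (r : rel T)
    (f g : T -> T) (s : R) :
    (forall u v, r u v -> f u = f v) ->
    (forall z, \sum_(u | f u == z) \sum_v (r u v)%:R <= s ^+ 2) ->
  (\sum_u \sum_v (r u v && (g u != g v))%:R) ^+ 2
    <= s ^+ 2 * (#|T|%:R ^+ 2 - \sum_z (\sum_(u | g u == z) 1) ^+ 2).
Proof.
move=> rf hs.
(* [c z z'] is the size of the intersection of component [z] with part [z'], and [e z] counts the
   coloured pairs in component [z] that join different parts. *)
pose c (z z' : T) : R := \sum_(a | (f a == z) && (g a == z')) 1.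
pose e (z : T) : R := \sum_(u | f u == z) \sum_v (r u v && (g u != g v))%:R.
have c0 z z' : 0 <= c z z' by apply: sumr_ge0.
have e0 z : 0 <= e z by do 2!apply: sumr_ge0 => ? _.
have es z : e z <= s ^+ 2.
  apply: le_trans (hs z); apply: ler_sum => u _; apply: ler_sum => v _.
  by case: (r u v) => //=; case: (_ != _).
have cE z : \sum_z' c z z' = \sum_(a | f a == z) 1.
  by rewrite [RHS](partition_big g predT).
have ec z : e z <= (\sum_z' c z z') ^+ 2 - \sum_z' c z z' ^+ 2.
  rewrite cE /c (sum_sqr_fibers _ _ (fun a => f a == z)) expr2 mulr_suml -sumrB.
  apply: ler_sum => u /eqP fu; rewrite mul1r -sumrB [leRHS]big_mkcond.
  apply: ler_sum => v _; case: (boolP (r u v)) => [/rf<-|_] /=.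
    by rewrite fu eqxx; case: (g u == g v); rewrite ?subrr ?subr0.
  by case: (f v == z) => //; case: (g u == g v); rewrite ?subrr ?subr0.
have := sum_components_le c0 e0 es ec.
have -> : \sum_z e z = \sum_u \sum_v (r u v && (g u != g v))%:R.
  by rewrite [RHS](partition_big f predT).
have -> : \sum_z \sum_z' c z z' = #|T|%:R.
  under eq_bigr do rewrite cE.
  by rewrite -sumr_const [RHS](partition_big f predT).
congr (_ <= _ * (_ - _)); apply: eq_bigr => z' _; congr (_ ^+ 2).
rewrite /c [RHS](partition_big f predT) //=; apply: eq_bigr => z _.
by apply: eq_bigl => a; rewrite andbC.
Qed.

(** Components enter only through labels [f j] constant along colour [j], and [D * #|T|] makes up
    for the uncoloured pairs. *)
Theorem count_pairs_le (R : realFieldType) (T : finType) (k : nat)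
    (r : 'I_k.+1 -> rel T) (f : 'I_k.+1 -> T -> T) (s D : R) :
    0 <= s -> 0 <= D ->
    (forall j u v, r j u v -> f j u = f j v) ->
    (forall i j u v, r i u v -> r j u v -> i = j) ->
    (forall j z, \sum_(u | f j u == z) \sum_v (r j u v)%:R <= s ^+ 2) ->
    #|T|%:R ^+ 2 <= D * #|T|%:R + \sum_j \sum_u \sum_v (r j u v)%:R ->
  #|T|%:R ^+ 2 <= (k.+1%:R ^+ 2 - k.+1%:R + 5%:R / 4%:R) * (s + 2%:R * D) ^+ 2.
Proof.
move=> s0 D0 rf disj hs htot.
pose A j : R := \sum_u \sum_v (r j u v)%:R.
case: (@arg_maxP _ _ _ ord0 predT A) => // i _ maxA.
set n : R := #|T|%:R in htot *; have n0 : 0 <= n by apply: ler0n.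
pose w : R := \sum_z (\sum_(u | f i u == z) 1) ^+ 2.
pose h j : R := \sum_u \sum_v (r j u v && (f i u != f i v))%:R.
have h_ge0 j : 0 <= h j by do 2!apply: sumr_ge0 => ? _.
have h_le j : h j ^+ 2 <= s ^+ 2 * (n ^+ 2 - w).
  by apply: (sum_crossing_le _ (rf j)); exact: hs.
have hi : h i = 0.
  rewrite /h big1 // => u _; rewrite big1 // => v _.
  by case: (boolP (r i u v)) => //= /rf->; rewrite eqxx.
have wE : w = \sum_a \sum_b (f i a == f i b)%:R.
  exact: (sum_sqr_fibers R (f i) predT).
(* A pair inside a part has at most one colour, so [w] covers these pairs; the coloured pairs
   between parts are counted by the [h j]. *)
have total : \sum_j A j <= w + \sum_j h j.
  rewrite /A /h wE exchange_big /= [X in _ + X]exchange_big /= -big_split.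
  apply: ler_sum => u _ /=; rewrite exchange_big /= [X in _ + X]exchange_big /=.
  rewrite -big_split; apply: ler_sum => v _ /=.
  case: eqP => [_|_] /=; last by rewrite add0r; apply: ler_sum => j _; rewrite andbT.
  rewrite [X in _ + X]big1 ?addr0; last by move=> j _; rewrite andbF.
  by apply: sum_disjoint_le1 => j j'; apply: disj.
(* Since [h i = 0], only [k] colours contribute, each at most the largest value [h l]. *)
case: (@arg_maxP _ _ _ ord0 predT h) => // l _ maxh.
have hsum : \sum_j h j <= k%:R * h l.
  rewrite (bigD1 i) //= hi add0r.
  apply: le_trans (_ : \sum_(j | j != i) h l <= _).
    by apply: ler_sum => j _; apply: maxh.
  by rewrite sumr_const cardC1 card_ord mulr_natl.
have hsum0 : 0 <= \sum_j h j by apply: sumr_ge0.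
have k1E : k.+1%:R - 1 = k%:R :> R by rewrite mulrS; ring.
have sumA : \sum_j A j <= k.+1%:R * A i.
  rewrite -[k.+1 in leRHS]card_ord mulr_natl -sumr_const.
  by apply: ler_sum => j _; apply: maxA.
have nE : \sum_z \sum_(u | f i u == z) 1 = n.
  by rewrite /n -sumr_const [RHS](partition_big (f i) predT).
have AE : \sum_z \sum_(u | f i u == z) \sum_v (r i u v)%:R = A i.
  by rewrite /A [RHS](partition_big (f i) predT).
have /= := @sum_sqr_sizes_le R T (fun z => \sum_(u | f i u == z) 1)
  (fun z => \sum_(u | f i u == z) \sum_v (r i u v)%:R) s s0 _ (hs i) _.
rewrite nE AE => [[||q0 hw]].
- by move=> z; apply: sumr_ge0.
- by move=> z; apply: sum_component_le_sqr; apply: rf.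
apply: (final_estimate _ n0 s0 D0 _ _ hw).
- by rewrite ler1n.
- by rewrite addrC; apply: le_trans htot _; rewrite lerD2l.
- by rewrite -subr_ge0.
rewrite -/w k1E; set m := _ * s ^+ 2.
have m0 : 0 <= m by rewrite mulr_ge0 ?sqr_ge0.
have Dn0 : 0 <= D * n by rewrite mulr_ge0.
have hH : n ^+ 2 - w - D * n <= k%:R * h l by lra.
(* For g = n^2 - w > D n, the bound (g - D n)^2 <= m g, expanded and divided by g, gives g <= m + 2
   D n. *)
have [|g_gt] := leP (n ^+ 2 - w) (D * n); first lra.
have hm : (n ^+ 2 - w - D * n) ^+ 2 <= m * (n ^+ 2 - w).
  apply: le_trans (_ : (k%:R * h l) ^+ 2 <= _).
    by rewrite lerXn2r // nnegrE; lra.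
  rewrite exprMn /m -mulrA; apply: ler_wpM2l; rewrite ?sqr_ge0 //; exact: h_le.
rewrite -subr_ge0 -(@pmulr_rge0 _ (n ^+ 2 - w)); last lra.
have := sqr_ge0 (D * n).
set g := n ^+ 2 - w in hm *.
have -> : g * (w + m + 2%:R * D * n - n ^+ 2)
  = m * g - (g - D * n) ^+ 2 + (D * n) ^+ 2 by rewrite /g; ring.
lra.
Qed.

(** * From pair counts to circuit lengths *)

Lemma binomial_bound (R : realFieldType) (n p : nat) (t c : R) : 0 < t ->
    n%:R ^+ 2 <= t * (2%:R * p%:R + 2%:R * c * n%:R) ->
  1 / t * 'C(n, 2)%:R - c * n%:R <= p%:R.
Proof.
move=> t0 h.
have hN : 2%:R * 'C(n, 2)%:R <= n%:R ^+ 2 :> R.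
  rewrite -natrX -natrM ler_nat bin2 mul2n -mulnn.
  apply: leq_trans (_ : n * n.-1 <= _)%N; last by rewrite leq_mul2l leq_pred orbT.
  by rewrite -{2}(odd_double_half (n * n.-1)) leq_addl.
by rewrite lerBlDr mul1r ler_pdivrMl //; lra.
Qed.

(** The error consists of the [n] diagonal pairs and, for each of the [k] colours, two ordered pairs
    for each of at most [n] deleted edges. *)
Lemma color_class_cover (n k : nat) (c : edge n -> 'I_k)
    (F0 F : 'I_k -> {set {set 'I_n}}) :
    (forall e : edge n, val e \in F0 (c e)) ->
    (forall j, #|F0 j :\: F j| <= n)%N ->
  (n ^ 2 <= (2 * k).+1 * n + \sum_j \sum_u \sum_v ([set u; v] \in F j))%N.
Proof.
move=> cF0 hF.
have -> : (n ^ 2 = \sum_(u < n) \sum_(v < n) 1)%N.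
  by under eq_bigr do rewrite sum1_card card_ord; rewrite sum_nat_const card_ord.
pose lost (j : 'I_k) (u v : 'I_n) := (u != v) && ([set u; v] \in F0 j :\: F j).
apply: leq_trans (_ : \sum_(u < n) \sum_(v < n) ((u == v) + \sum_j lost j u v +
    \sum_j ([set u; v] \in F j)) <= _)%N.
  apply: leq_sum => u _; apply: leq_sum => v _.
  have [//|uv] := eqVneq u v; rewrite add0n.
  have uv2 : #|[set u; v]| == 2 by rewrite cards2 uv.
  have := cF0 (exist (fun e : {set 'I_n} => #|e| == 2) _ uv2).
  set j := c _ => /= uvj; rewrite (bigD1 j) //= [X in (_ <= _ + X)%N](bigD1 j) //=.
  by rewrite !addn_gt0 /lost uv in_setD uvj andbT; case: (_ \in F j); rewrite ?orbT.
have -> : (\sum_(u < n) \sum_(v < n) ((u == v) + \sum_j lost j u v +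
      \sum_j ([set u; v] \in F j)) = \sum_(u < n) \sum_(v < n) (u == v) +
    \sum_(u < n) \sum_(v < n) \sum_j lost j u v +
    \sum_(u < n) \sum_(v < n) \sum_j ([set u; v] \in F j))%N.
  by rewrite -!big_split; apply: eq_bigr => u _; rewrite -!big_split.
have exch (G : 'I_k -> 'I_n -> 'I_n -> nat) :
    (\sum_u \sum_v \sum_j G j u v = \sum_j \sum_u \sum_v G j u v)%N.
  by rewrite [RHS]exchange_big; apply: eq_bigr => u _; rewrite [RHS]exchange_big.
rewrite leq_add //; last first.
  by rewrite exch.
rewrite mulSn leq_add //.
  rewrite -[leqRHS]card_ord -sum1_card; apply: leq_sum => u _.
  by rewrite (bigD1 u) //= eqxx big1 // => v; rewrite eq_sym => /negPf->.
rewrite exch.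
rewrite mulnAC mulnC -[k in leqRHS]card_ord -sum_nat_const; apply: leq_sum => j _.
by apply: leq_trans (card_pairs_in_edges _) _; rewrite leq_mul2l hF.
Qed.

Theorem corollary8 (R : realFieldType) (k : nat) (k_gt0 : (0 < k)%N) :
  exists C : R, forall (n : nat) (c : edge n -> 'I_k), (1 <= n)%N ->
    (exists (x : 'I_n) (p : seq 'I_n),
       [/\ is_circuit x p, monochromatic c x p
         & 1 / (k%:R ^+ 2 - k%:R + 5%:R / 4%:R) * ('C(n, 2))%:R - C * n%:R
             <= (size p)%:R])
    /\
    (exists (x : 'I_n) (p : seq 'I_n),
       [/\ is_trail x p, monochromatic c x p
         & 1 / (k%:R ^+ 2 - k%:R + 5%:R / 4%:R) * ('C(n, 2))%:R - C * n%:R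
             <= (size p)%:R]).
Proof.
case: k k_gt0 => // k _.
(* [D] is the constant of [color_class_cover] for [k.+1] colours, and [m] is chosen so that (s + 1)
   + 2 D = s + m. *)
pose D := (2 * k.+1).+1; pose m : R := 2%:R * D%:R + 1.
exists (m ^+ 2) => n c n_gt0.
set t : R := _ ^+ 2 - _ + _.
have t_gt0 : 0 < t.
  have : 0 <= k.+1%:R * (k.+1%:R - 1) :> R by rewrite mulr_ge0 // subr_ge0 ler1n.
  have -> : k.+1%:R * (k.+1%:R - 1) = k.+1%:R ^+ 2 - k.+1%:R :> R by ring.
  rewrite /t; lra.
have m_ge1 : 1 <= m by rewrite lerDr mulr_ge0.
have n_ge1 : 1 <= n%:R :> R by rewrite ler1n.
have m2 : m <= m ^+ 2 by rewrite expr2 ler_peMl //; lra.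
suff [x [p [cp mp lp]]] : exists (x : 'I_n) (p : seq 'I_n),
    [/\ is_circuit x p, monochromatic c x p
      & n%:R ^+ 2 <= t * (2%:R * (size p)%:R + 2%:R * m ^+ 2 * n%:R)].
  split; exists x, p; split; rewrite ?binomial_bound //.
  by case/andP: cp.
pose F0 j : {set {set 'I_n}} :=
  [set val e | e : {e : {set 'I_n} | #|e| == 2} & c e == j].
have F0P j e : e \in F0 j -> #|e| = 2%N by case/imsetP=> [[e' /= /eqP]] ? _ ->.
have evensub j : exists E : {set {set 'I_n}},
    [/\ E \subset F0 j, even_graph E & (#|F0 j :\: E| <= n)%N].
  by have [E hE] := even_subgraph_large (F0 j); exists E; rewrite card_ord in hE.
have [F hF] := fin_all_exists evensub.
have FF0 j e : e \in F j -> e \in F0 j by have [/subsetP/(_ e)] := hF j.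
have F2 j e : e \in F j -> #|e| = 2%N by move/FF0/F0P.
pose r j : rel 'I_n := [rel u v | [set u; v] \in F j].
have rsym j : connect_sym (r j) by apply: sym_connect_sym => a b; rewrite /r /= setUC.
(* [P s] bounds every monochromatic component by s^2 ordered pairs. For the least such [s], the
   bound with s - 1 fails somewhere, which singles out a large component. *)
pose P (s : nat) := [forall j, forall z : 'I_n,
  (\sum_(u | fingraph.root (r j) u == z) \sum_v ([set u; v] \in F j) <= s ^ 2)%N].
have Pn : P n.
  apply/forallP=> j; apply/forallP=> z.
  apply: leq_trans (_ : \sum_(u < n) \sum_(v < n) 1 <= _)%N.
    rewrite big_mkcond leq_sum // => u _; case: ifP => // _.
    by rewrite leq_sum // => v _; case: (_ \in _).
  by under eq_bigr do rewrite sum1_card card_ord; rewrite sum_nat_const card_ord.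
have [s Ps min_s] := ex_minnP (ex_intro P n Pn).
have hn : n%:R ^+ 2 <= t * (s%:R + 2%:R * D%:R) ^+ 2.
  have := @count_pairs_le R 'I_n k r (fun j => fingraph.root (r j)) s%:R D%:R.
  rewrite card_ord; apply=> //.
  - by move=> j u v uv; apply/eqP; rewrite root_connect //; apply: connect1.
  - move=> i j u v /FF0/imsetP[e]; rewrite inE => /eqP ce uve.
    move=> /FF0/imsetP[e']; rewrite inE => /eqP ce'.
    by rewrite uve => /val_inj ee; rewrite -ce ee.
  - move=> j z; have /forallP/(_ z) := forallP Ps j.
    by rewrite -natrX -(ler_nat R) natr_sum; under eq_bigr do rewrite natr_sum.
  - have -> : \sum_j \sum_u \sum_v (r j u v)%:R
        = (\sum_j \sum_u \sum_v ([set u; v] \in F j))%:R :> R.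
      rewrite natr_sum; apply: eq_bigr => j _; rewrite natr_sum.
      by apply: eq_bigr => u _; rewrite natr_sum.
    rewrite -natrX -natrM -natrD ler_nat.
    apply: (@color_class_cover _ _ c F0) => [e|j]; last by have [] := hF j.
    by apply/imsetP; exists e; rewrite // inE.
(* If the least value is 0, the trivial circuit suffices, as n^2 <= t (2 D)^2 is within the error
   term. *)
case: s Ps min_s hn => [|s] Ps min_s hn.
  exists (Ordinal n_gt0), [::]; split=> //; apply: le_trans hn _.
  rewrite ler_wpM2l ?(ltW t_gt0) //= !mulr0n mulr0 !add0r.
  have : m ^+ 2 * 1 <= m ^+ 2 * n%:R by rewrite ler_wpM2l ?sqr_ge0.
  have -> : m ^+ 2 = (2%:R * D%:R) ^+ 2 + 2%:R * (2%:R * D%:R) + 1 by rewrite /m; ring.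
  have := ler0n R D; have := sqr_ge0 (2%:R * D%:R : R).
  by lra.
have s_le_n : (s < n)%N by apply: min_s.
have : ~~ P s by apply/negP=> /min_s; rewrite ltnn.
rewrite negb_forall => /existsP[j]; rewrite negb_forall => /existsP[z].
rewrite -ltnNge => z_big.
have [_ ev _] := hF j.
have [y [p [cp pF cov]]] := euler_circuit z (@F2 j) ev.
(* The circuit uses every edge of the component with root [z], and each edge accounts for at most
   two of its more than s^2 ordered pairs. *)
have sp : (s ^ 2 <= 2 * size p)%N.
  apply: leq_trans (ltnW z_big) _.
  pose L := [set e in walk_edges y p].
  apply: leq_trans (_ : \sum_u \sum_v ((u != v) && ([set u; v] \in L) : nat) <= _)%N.
    rewrite big_mkcond leq_sum // => u _; case: eqP => // uz.
    rewrite leq_sum // => v _; case: (boolP (_ \in F j)) => // uv.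
    rewrite inE (cov u v) // ?andbT.
      by have := F2 _ _ uv; rewrite cards2; case: (u == v).
    by rewrite -uz rsym connect_root.
  apply: leq_trans (card_pairs_in_edges _) _; rewrite leq_mul2l /=.
  by rewrite -(size_walk_edges y p) cardsE card_size.
exists y, p; split=> //.
  have cj e : val e \in walk_edges y p -> c e = j.
    by move=> /pF/FF0/imsetP[e']; rewrite inE => /eqP <- /val_inj->.
  by move=> e f /cj-> /cj->.
apply: le_trans hn _; rewrite ler_wpM2l ?(ltW t_gt0) //.
have sp' : s%:R ^+ 2 <= 2%:R * (size p)%:R :> R.
  by rewrite -natrX -natrM ler_nat.
(* Going from [s] to [s.+1] and adding 2 D costs 2 m s + m^2, which is at most 2 m^2 n because s + 1
   <= n. *)
have -> : (s.+1%:R + 2%:R * D%:R) ^+ 2 = s%:R ^+ 2 + (2%:R * m * s%:R + m ^+ 2) :> R.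
  by rewrite /m mulrS; ring.
apply: lerD => //.
have h1 : m * s%:R <= m ^+ 2 * s%:R by rewrite ler_wpM2r.
have h2 : m ^+ 2 * (s.+1)%:R <= m ^+ 2 * n%:R by rewrite ler_wpM2l ?sqr_ge0 ?ler_nat.
rewrite mulrS mulrDr mulr1 in h2; lra.
Qed.
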